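(* Let $H$ be a Hopf algebra over a commutative unital integral domain $R$, let $\Pi$ be a finite subgroup of weights of $H$, and let $h_1,\dots,h_n\in H$ ($n\ge1$) be skew-primitive, with $\Delta(h_i)=g_i\otimes h_i+h_i\otimes g_i'$ for grouplike $g_i,g_i'$. Let $\mathbf h=\prod_{i=1}^n h_i$. If $\mathrm{char}(R)\nmid|\Pi|$ and $g_i^{-1}g_i'\in G_\Pi(H)$ (i.e. $h_i$ is pseudo-primitive with respect to $\Pi$) for some $i$, then $\gamma(h_i)=0$ for all $\gamma\in\Pi$. In particular, $\Sigma_\Pi(\mathbf h)=0$.
   Context: A weight of $H$ is an $R$-algebra homomorphism $H\to R$. The set $\Gamma_H$ of weights is a group under convolution $(\lambda*\nu)(h)=(\lambda\otimes\nu)(\Delta(h))$, with identity the counit $\varepsilon$ and inverse $\lambda^{-1}=\lambda\circ S$. $\Pi\subset\Gamma_H$ is a finite subgroup, and $\Sigma_\Pi:=\sum_{\gamma\in\Pi}\gamma:H\to R$. $G(H)$ is the group of grouplike elements ($\Delta(g)=g\otimes g$, $\varepsilon(g)=1$), and $G_\Pi(H)=\{g\in G(H):\gamma(g)=1\ \forall\gamma\in\Pi\}$. The condition $\mathrm{char}(R)\nmid|\Pi|$ includes the case $\mathrm{char}(R)=0$. *)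

(* Defs.v *)
From HB Require Import structures.
From mathcomp Require Import all_boot all_order all_algebra.
From mathcomp Require Import sesquilinear finmap.
From mathcomp Require Import boolp.

Set Implicit Arguments.
Unset Strict Implicit.
Unset Printing Implicit Defensive.

Import GRing.Theory.
Local Open Scope ring_scope.

Reserved Notation "u ⊗ v" (at level 40, left associativity).

Section Bilinear.
Variables (R : comNzRingType) (U V W : lmodType R) (f : U -> V -> W).

Lemma bilinearW :
  (forall u u' v, f (u + u') v = f u v + f u' v) ->
  (forall u v v', f u (v + v') = f u v + f u v') ->
  (forall a u v, f (a *: u) v = a *: f u v) ->
  (forall a u v, f u (a *: v) = a *: f u v) ->
  bilinear_for *:%R *:%R f.
Proof. by move=> Dl Dr Zl Zr; split=> w a x y; rewrite ?(Dl, Dr, Zl, Zr). Qed.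

Hypothesis f_bilin : bilinear_for *:%R *:%R f.

Lemma bilinDl u u' v : f (u + u') v = f u v + f u' v.
Proof. by have /= := f_bilin.1 v 1 u u'; rewrite !scale1r. Qed.
Lemma bilinDr u v v' : f u (v + v') = f u v + f u v'.
Proof. by have /= := f_bilin.2 u 1 v v'; rewrite !scale1r. Qed.
Lemma bilin0l v : f 0 v = 0.
Proof. by apply: (addrI (f 0 v)); rewrite -bilinDl !addr0. Qed.
Lemma bilin0r u : f u 0 = 0.
Proof. by apply: (addrI (f u 0)); rewrite -bilinDr !addr0. Qed.
Lemma bilinZl a u v : f (a *: u) v = a *: f u v.
Proof. by have /= := f_bilin.1 v a u 0; rewrite bilin0l !addr0. Qed.
Lemma bilinZr a u v : f u (a *: v) = a *: f u v.
Proof. by have /= := f_bilin.2 u a v 0; rewrite bilin0r !addr0. Qed.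

End Bilinear.

Section TensorProduct.
Local Open Scope quotient_scope.
Variables (R : comNzRingType) (U V : lmodType R).

(* A list of pairs stands for the formal sum of its entries; [tens_eq] is the
   smallest additive congruence making the pairing balanced. *)
Inductive tens_eq : seq (U * V) -> seq (U * V) -> Prop :=
| TensRefl s : tens_eq s s
| TensSym s t : tens_eq s t -> tens_eq t s
| TensTrans s t r : tens_eq s t -> tens_eq t r -> tens_eq s r
| TensCat s s' t t' :
    tens_eq s s' -> tens_eq t t' -> tens_eq (s ++ t) (s' ++ t')
| TensCatC s t : tens_eq (s ++ t) (t ++ s)
| TensDl u u' v : tens_eq [:: (u + u', v)] [:: (u, v); (u', v)]
| TensDr u v v' : tens_eq [:: (u, v + v')] [:: (u, v); (u, v')]
| TensZ a u v : tens_eq [:: (a *: u, v)] [:: (u, a *: v)]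
| Tens0 v : tens_eq [:: (0, v)] [::].

Definition tens_eqb (s t : seq (U * V)) : bool := `[< tens_eq s t >].

Lemma tens_eqb_refl : reflexive tens_eqb.
Proof. by move=> s; apply/asboolP; exact: TensRefl. Qed.

Lemma tens_eqb_sym : symmetric tens_eqb.
Proof. by move=> s t; apply/asboolP/asboolP; exact: TensSym. Qed.

Lemma tens_eqb_trans : transitive tens_eqb.
Proof.
move=> t s r /asboolP st /asboolP tr; apply/asboolP; exact: TensTrans st tr.
Qed.

Canonical tens_equiv :=
  EquivRel tens_eqb tens_eqb_refl tens_eqb_sym tens_eqb_trans.

Definition tensor : Type := {eq_quot tens_equiv}.

HB.instance Definition _ := Choice.on tensor.

Definition tens_class (s : seq (U * V)) : tensor := \pi_{eq_quot tens_equiv} s.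
Definition tens_repr (t : tensor) : seq (U * V) :=
  repr (t : {eq_quot tens_equiv}).

Lemma tens_classP s t : tens_class s = tens_class t <-> tens_eq s t.
Proof.
split; first by move/eqmodP => /asboolP.
by move=> st; apply/eqmodP/asboolP.
Qed.

Lemma tens_reprK : cancel tens_repr tens_class.
Proof. by move=> t; rewrite /tens_class /tens_repr reprK. Qed.

Lemma tens_reprP s : tens_eq (tens_repr (tens_class s)) s.
Proof. by apply/tens_classP; rewrite tens_reprK. Qed.

Definition tens (u : U) (v : V) : tensor := tens_class [:: (u, v)].
Local Notation "u ⊗ v" := (tens u v).

Let zscale (a : R) (s : seq (U * V)) := [seq (a *: p.1, p.2) | p <- s].

Lemma zscale_eq a s t : tens_eq s t -> tens_eq (zscale a s) (zscale a t).
Proof.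
elim=> {s t}.
- by move=> s; exact: TensRefl.
- by move=> s t _; exact: TensSym.
- by move=> s t r _ st _; exact: TensTrans.
- by move=> s s' t t' _ ss' _ tt'; rewrite /zscale !map_cat; exact: TensCat.
- by move=> s t; rewrite /zscale !map_cat; exact: TensCatC.
- by move=> u u' v; rewrite /= scalerDr; exact: TensDl.
- by move=> u v v'; exact: TensDr.
- move=> b u v; rewrite /= scalerA [_ * _]mulrC -scalerA; exact: TensZ.
- by move=> v; rewrite /= scaler0; exact: Tens0.
Qed.

Definition tens_zero : tensor := tens_class [::].
Definition tens_add (s t : tensor) : tensor :=
  tens_class (tens_repr s ++ tens_repr t).
Definition tens_scale (a : R) (t : tensor) : tensor :=
  tens_class [seq (a *: p.1, p.2) | p <- tens_repr t].
Definition tens_opp (t : tensor) : tensor := tens_scale (-1) t.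

Lemma tens_addE s t :
  tens_add (tens_class s) (tens_class t) = tens_class (s ++ t).
Proof. by apply/tens_classP/TensCat; exact: tens_reprP. Qed.

Lemma tens_scaleE a s :
  tens_scale a (tens_class s) = tens_class [seq (a *: p.1, p.2) | p <- s].
Proof. by apply/tens_classP/zscale_eq; exact: tens_reprP. Qed.

Fact tens_addA : associative tens_add.
Proof.
move=> r s t; rewrite -[r]tens_reprK -[s]tens_reprK -[t]tens_reprK.
by rewrite !tens_addE catA.
Qed.

Fact tens_addC : commutative tens_add.
Proof.
move=> s t; rewrite -[s]tens_reprK -[t]tens_reprK.
by rewrite !tens_addE; apply/tens_classP/TensCatC.
Qed.

Fact tens_add0 : left_id tens_zero tens_add.
Proof. by move=> s; rewrite -[s]tens_reprK tens_addE. Qed.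

Fact tens_scaleDl t : {morph tens_scale^~ t : a b / a + b >-> tens_add a b}.
Proof.
move=> a b; rewrite -[t]tens_reprK; elim: (tens_repr t) => [|p s IHs].
  by rewrite !tens_scaleE tens_addE.
rewrite -cat1s -tens_addE.
have scaleD c r r' : tens_scale c (tens_add (tens_class r) (tens_class r'))
    = tens_add (tens_scale c (tens_class r)) (tens_scale c (tens_class r')).
  by rewrite tens_addE !tens_scaleE tens_addE map_cat.
have ACA : interchange tens_add tens_add.
  move=> x y z w; rewrite -!tens_addA; congr tens_add.
  by rewrite !tens_addA (tens_addC y z).
rewrite !scaleD IHs ACA; congr tens_add.
by rewrite !tens_scaleE tens_addE /= scalerDl; apply/tens_classP/TensDl.
Qed.

Fact tens_scale0 t : tens_scale 0 t = tens_zero.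
Proof.
rewrite -[t]tens_reprK; elim: (tens_repr t) => [|p s IHs].
  by rewrite tens_scaleE.
rewrite tens_scaleE /= scale0r -cat1s -tens_addE -tens_scaleE IHs tens_addE.
by rewrite cats0; apply/tens_classP/Tens0.
Qed.

Fact tens_scale1 : left_id 1 tens_scale.
Proof.
move=> t; rewrite -[t]tens_reprK tens_scaleE; congr tens_class.
by rewrite -[RHS]map_id; apply: eq_map => -[u v]; rewrite /= scale1r.
Qed.

Fact tens_addN : left_inverse tens_zero tens_opp tens_add.
Proof.
by move=> t; rewrite -{2}[t]tens_scale1 -tens_scaleDl addNr tens_scale0.
Qed.

HB.instance Definition _ :=
  GRing.isZmodule.Build tensor tens_addA tens_addC tens_add0 tens_addN.

Fact tens_scaleA a b t : tens_scale a (tens_scale b t) = tens_scale (a * b) t.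
Proof.
rewrite -[t]tens_reprK !tens_scaleE -map_comp; congr tens_class.
by apply: eq_map => -[u v]; rewrite /= scalerA.
Qed.

Fact tens_scaleDr : right_distributive tens_scale +%R.
Proof.
move=> a s t; rewrite -[s]tens_reprK -[t]tens_reprK.
by rewrite [_ + _]tens_addE !tens_scaleE map_cat -tens_addE.
Qed.

HB.instance Definition _ := GRing.Zmodule_isLmodule.Build R tensor
  tens_scaleA tens_scale1 tens_scaleDr tens_scaleDl.

Lemma tens_classD s t : tens_class s + tens_class t = tens_class (s ++ t).
Proof. exact: tens_addE. Qed.

Lemma tens_classZ a s :
  a *: tens_class s = tens_class [seq (a *: p.1, p.2) | p <- s].
Proof. exact: tens_scaleE. Qed.

Lemma tens_bilinear : bilinear_for *:%R *:%R tens.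
Proof.
have Zl a u v : (a *: u) ⊗ v = a *: (u ⊗ v) by rewrite [RHS]tens_scaleE.
apply: bilinearW => //.
- by move=> u u' v; rewrite [RHS]tens_addE; apply/tens_classP/TensDl.
- by move=> u v v'; rewrite [RHS]tens_addE; apply/tens_classP/TensDr.
- by move=> a u v; rewrite -Zl; apply/tens_classP/TensSym/TensZ.
Qed.

HB.instance Definition _ :=
  bilinear_isBilinear.Build R U V tensor *:%R *:%R tens tens_bilinear.

Lemma tensDl u u' v : (u + u') ⊗ v = u ⊗ v + u' ⊗ v.
Proof. exact: bilinDl tens_bilinear _ _ _. Qed.
Lemma tensDr u v v' : u ⊗ (v + v') = u ⊗ v + u ⊗ v'.
Proof. exact: bilinDr tens_bilinear _ _ _. Qed.
Lemma tensZl a u v : (a *: u) ⊗ v = a *: (u ⊗ v).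
Proof. exact: bilinZl tens_bilinear _ _ _. Qed.
Lemma tensZr a u v : u ⊗ (a *: v) = a *: (u ⊗ v).
Proof. exact: bilinZr tens_bilinear _ _ _. Qed.

Lemma tens_sum (s : seq (U * V)) : tens_class s = \sum_(p <- s) p.1 ⊗ p.2.
Proof.
elim: s => [|[u v] s IHs]; first by rewrite big_nil.
by rewrite big_cons -IHs -cat1s -tens_addE.
Qed.

Lemma tens_repr_sum t : t = \sum_(p <- tens_repr t) p.1 ⊗ p.2.
Proof. by rewrite -tens_sum tens_reprK. Qed.

Lemma tens_ind (P : tensor -> Prop) :
  P 0 -> (forall u v t, P t -> P (u ⊗ v + t)) -> forall t, P t.
Proof.
move=> P0 PD t; rewrite (tens_repr_sum t); elim: (tens_repr t) => [|p s IHs].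
  by rewrite big_nil.
by rewrite big_cons; exact: PD.
Qed.

End TensorProduct.

Notation "u ⊗ v" := (tens u v) : ring_scope.

Section TensorLift.
Variables (R : comNzRingType) (U V : lmodType R).

(* The linear map induced by a bilinear one: the sum is taken over some list
   representing [t], and [tlift_linear], [tliftE] show that the choice is
   immaterial as soon as [f] is bilinear. *)
Definition tlift (W : zmodType) (f : U -> V -> W) (t : tensor U V) : W :=
  \sum_(p <- tens_repr t) f p.1 p.2.

Variables (W : lmodType R) (f : U -> V -> W).
Hypothesis f_bilin : bilinear_for *:%R *:%R f.

Lemma tlift_class s : tlift f (tens_class s) = \sum_(p <- s) f p.1 p.2.
Proof.
have [Dl Dr] := (bilinDl f_bilin, bilinDr f_bilin).
have [Zl Zr] := (bilinZl f_bilin, bilinZr f_bilin).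
have sum_eq s1 s2 : tens_eq s1 s2 ->
    \sum_(p <- s1) f p.1 p.2 = \sum_(p <- s2) f p.1 p.2; last first.
  exact/sum_eq/tens_reprP.
elim=> {s s1 s2}.
- by [].
- by move=> s t _ ->.
- by move=> s t r _ -> _ ->.
- by move=> s s' t t' _ ss' _ tt'; rewrite !big_cat /= ss' tt'.
- by move=> s t; rewrite !big_cat /= addrC.
- by move=> u u' v; rewrite !big_cons !big_nil /= Dl !addr0.
- by move=> u v v'; rewrite !big_cons !big_nil /= Dr !addr0.
- by move=> a u v; rewrite !big_cons !big_nil /= Zl Zr.
- by move=> v; rewrite big_cons !big_nil /= -(scale0r 0) Zl scale0r addr0.
Qed.

Lemma tliftE u v : tlift f (u ⊗ v) = f u v.
Proof. by rewrite tlift_class big_cons big_nil addr0. Qed.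

Lemma tliftD s t : tlift f (s + t) = tlift f s + tlift f t.
Proof.
rewrite -[s]tens_reprK -[t]tens_reprK tens_classD.
by rewrite !tlift_class big_cat.
Qed.

Lemma tliftZ a t : tlift f (a *: t) = a *: tlift f t.
Proof.
rewrite -[t]tens_reprK tens_classZ !tlift_class big_map scaler_sumr.
by apply: eq_bigr => p _; rewrite (bilinZl f_bilin).
Qed.

Lemma tlift_linear : linear (tlift f).
Proof. by move=> a s t; rewrite tliftD tliftZ. Qed.

End TensorLift.

Lemma eq_tlift (R : comNzRingType) (U V : lmodType R) (W : zmodType)
    (f g : U -> V -> W) : f =2 g -> tlift f =1 tlift g.
Proof. by move=> fg t; apply: eq_bigr => p _; exact: fg. Qed.

Lemma tlift_addf (R : comNzRingType) (U V : lmodType R) (W : zmodType)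
    (f g : U -> V -> W) t :
  tlift (fun u v => f u v + g u v) t = tlift f t + tlift g t.
Proof. exact: big_split. Qed.

Lemma tlift_scalef (R : comNzRingType) (U V W : lmodType R)
    (f : U -> V -> W) a t :
  tlift (fun u v => a *: f u v) t = a *: tlift f t.
Proof. by rewrite /tlift scaler_sumr. Qed.

Section TensorMaps.
Variables (R : comNzRingType).

Definition tmap (U V U' V' : lmodType R) (f : U -> U') (g : V -> V') :
    tensor U V -> tensor U' V' :=
  tlift (fun u v => f u ⊗ g v).

Definition tassoc (U V W : lmodType R) :
    tensor (tensor U V) W -> tensor U (tensor V W) :=
  tlift (fun t w => tlift (fun u v => u ⊗ (v ⊗ w)) t).

Lemma tmap_bilinear (U V U' V' : lmodType R)
    (f : {linear U -> U'}) (g : {linear V -> V'}) :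
  bilinear_for *:%R *:%R (fun u v => f u ⊗ g v).
Proof.
by apply: bilinearW => *;
  rewrite ?(linearD, linearZ, tensDl, tensDr, tensZl, tensZr).
Qed.

Lemma tmapE (U V U' V' : lmodType R)
    (f : {linear U -> U'}) (g : {linear V -> V'}) u v :
  tmap f g (u ⊗ v) = f u ⊗ g v.
Proof. exact: tliftE (tmap_bilinear f g) _ _. Qed.

Lemma tassoc_bilinear_in (U V W : lmodType R) (w : W) :
  bilinear_for *:%R *:%R (fun (u : U) (v : V) => u ⊗ (v ⊗ w)).
Proof. by apply: bilinearW => *; rewrite ?(tensDl, tensDr, tensZl, tensZr). Qed.

Lemma tassoc_bilinear (U V W : lmodType R) :
  bilinear_for *:%R *:%R
    (fun t (w : W) => tlift (fun (u : U) (v : V) => u ⊗ (v ⊗ w)) t).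
Proof.
apply: bilinearW => [t t' w|t w w'|a t w|a t w].
- by rewrite (tliftD (tassoc_bilinear_in _ _ w)).
- by rewrite -tlift_addf; apply: eq_tlift => u v; rewrite !tensDr.
- by rewrite (tliftZ (tassoc_bilinear_in _ _ w)).
- by rewrite -tlift_scalef; apply: eq_tlift => u v; rewrite !tensZr.
Qed.

Lemma tassocE (U V W : lmodType R) (u : U) (v : V) (w : W) :
  tassoc ((u ⊗ v) ⊗ w) = u ⊗ (v ⊗ w).
Proof.
rewrite /tassoc (tliftE (@tassoc_bilinear U V W)).
exact: tliftE (tassoc_bilinear_in _ _ w) _ _.
Qed.

End TensorMaps.

Section TensorAlgebra.
Variables (R : comNzRingType) (A B : algType R).
Implicit Types (r s t : tensor A B).

Definition tens_one : tensor A B := 1 ⊗ 1.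
Definition tens_mul s t : tensor A B :=
  tlift (fun a b => tlift (fun c d => (a * c) ⊗ (b * d)) t) s.

Lemma tens_mul_bilinear_in a b :
  bilinear_for *:%R *:%R (fun (c : A) (d : B) => (a * c) ⊗ (b * d)).
Proof.
by apply: bilinearW => *;
  rewrite -?(scalerAr, mulrDr) ?(mulrDr, tensDl, tensDr, tensZl, tensZr).
Qed.

Lemma tens_mul_bilinear t : bilinear_for *:%R *:%R
  (fun (a : A) (b : B) => tlift (fun c d => (a * c) ⊗ (b * d)) t).
Proof.
apply: bilinearW => [a a' b|a b b'|k a b|k a b].
- by rewrite -tlift_addf; apply: eq_tlift => c d; rewrite mulrDl tensDl.
- by rewrite -tlift_addf; apply: eq_tlift => c d; rewrite mulrDl tensDr.
- by rewrite -tlift_scalef; apply: eq_tlift => c d; rewrite -scalerAl tensZl.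
- by rewrite -tlift_scalef; apply: eq_tlift => c d; rewrite -scalerAl tensZr.
Qed.

Lemma tens_mulE a b c d :
  tens_mul (a ⊗ b) (c ⊗ d) = (a * c) ⊗ (b * d).
Proof.
rewrite /tens_mul (tliftE (tens_mul_bilinear _)).
exact: tliftE (tens_mul_bilinear_in _ _) _ _.
Qed.

Fact tens_mulDl : left_distributive tens_mul +%R.
Proof. by move=> r s t; rewrite /tens_mul (tliftD (tens_mul_bilinear t)). Qed.

Fact tens_mulDr : right_distributive tens_mul +%R.
Proof.
move=> r s t; rewrite /tens_mul -tlift_addf.
by apply: eq_tlift => a b; rewrite (tliftD (tens_mul_bilinear_in _ _)).
Qed.

Fact tens_mulZl a s t : a *: tens_mul s t = tens_mul (a *: s) t.
Proof. by rewrite /tens_mul (tliftZ (tens_mul_bilinear t)). Qed.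

Fact tens_mulZr a s t : a *: tens_mul s t = tens_mul s (a *: t).
Proof.
rewrite /tens_mul -tlift_scalef.
by apply: eq_tlift => c d; rewrite (tliftZ (tens_mul_bilinear_in _ _)).
Qed.

Let mul0s t : tens_mul 0 t = 0.
Proof. by have := tens_mulZl 0 0 t; rewrite !scale0r. Qed.

Let muls0 t : tens_mul t 0 = 0.
Proof. by have := tens_mulZr 0 t 0; rewrite !scale0r. Qed.

Fact tens_mulA : associative tens_mul.
Proof.
move=> r s t; elim/tens_ind: r => [|a b r IHr]; first by rewrite !mul0s.
rewrite !tens_mulDl IHr; congr (_ + _) => {r IHr}.
elim/tens_ind: s => [|c d s IHs]; first by rewrite !(mul0s, muls0).
rewrite !(tens_mulDl, tens_mulDr) IHs; congr (_ + _) => {s IHs}.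
elim/tens_ind: t => [|e f t IHt]; first by rewrite !muls0.
by rewrite !tens_mulDr IHt !tens_mulE !mulrA.
Qed.

Fact tens_mul1s : left_id tens_one tens_mul.
Proof.
elim/tens_ind => [|a b t IHt]; first exact: muls0.
by rewrite tens_mulDr IHt tens_mulE !mul1r.
Qed.

Fact tens_muls1 : right_id tens_one tens_mul.
Proof.
elim/tens_ind => [|a b t IHt]; first exact: mul0s.
by rewrite tens_mulDl IHt tens_mulE !mulr1.
Qed.

(* Only a possibly trivial ring: [A ⊗ B] may vanish for nonzero [A] and [B]. *)
HB.instance Definition _ := GRing.Zmodule_isPzRing.Build (tensor A B)
  tens_mulA tens_mul1s tens_muls1 tens_mulDl tens_mulDr.

Lemma mul_tens (a c : A) (b d : B) : (a ⊗ b) * (c ⊗ d) = (a * c) ⊗ (b * d).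
Proof. exact: tens_mulE. Qed.

Lemma tens11 : 1 ⊗ 1 = 1 :> tensor A B.
Proof. by []. Qed.

End TensorAlgebra.

HB.mixin Record Algebra_isHopfAlgebra (R : comNzRingType) H
    of GRing.Algebra R H := {
  comul : {lrmorphism H -> tensor H H | *:%R};
  counit : {lrmorphism H -> R^o};
  antipode : {linear H -> H};
  comulA : forall h : H,
    tassoc (tmap comul idfun (comul h)) = tmap idfun comul (comul h);
  counitl : forall h : H, tlift (fun a b => counit a *: b) (comul h) = h;
  counitr : forall h : H, tlift (fun a b => counit b *: a) (comul h) = h;
  antipodel : forall h : H,
    tlift (fun a b => antipode a * b) (comul h) = (counit h)%:A;
  antipoder : forall h : H,
    tlift (fun a b => a * antipode b) (comul h) = (counit h)%:A;
}.

#[short(type="hopfAlgType")]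
HB.structure Definition HopfAlgebra (R : comNzRingType) :=
  {H of Algebra_isHopfAlgebra R H & GRing.Algebra R H}.

Section HopfTheory.
Variables (R : comNzRingType) (H : hopfAlgType R).
Implicit Types (W : lmodType R).

Lemma comulM (x y : H) : comul (x * y) = comul x * comul y.
Proof. exact: rmorphM. Qed.

Lemma comul1 : comul (1 : H) = 1.
Proof. exact: rmorph1. Qed.

Lemma comulP k (x y : H) : comul (k *: x + y) = k *: comul x + comul y.
Proof. exact: linearP. Qed.

Lemma counitM (x y : H) : counit (x * y) = counit x * counit y.
Proof. exact: rmorphM. Qed.

Lemma counit1 : counit (1 : H) = 1.
Proof. exact: rmorph1. Qed.

Lemma tlift_sum (U V W : lmodType R) (f : U -> V -> W) I (s : seq I)
    (F : I -> tensor U V) :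
  bilinear_for *:%R *:%R f ->
  tlift f (\sum_(i <- s) F i) = \sum_(i <- s) tlift f (F i).
Proof.
move=> fB; elim: s => [|i s IHs].
  rewrite !big_nil; have := tliftZ fB 0 0; rewrite !scale0r; exact.
by rewrite !big_cons (tliftD fB) IHs.
Qed.

Lemma coassocP W (F : H -> H -> H -> W) h :
  (forall a, bilinear_for *:%R *:%R (F a)) ->
  (forall a a' b c, F (a + a') b c = F a b c + F a' b c) ->
  (forall k a b c, F (k *: a) b c = k *: F a b c) ->
  tlift (fun a c => tlift (fun a1 a2 => F a1 a2 c) (comul a)) (comul h) =
  tlift (fun a b => tlift (fun b1 b2 => F a b1 b2) (comul b)) (comul h).
Proof.
move=> FB FD FZ.
have GB : bilinear_for *:%R *:%R (fun a s => tlift (F a) s).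
  apply: bilinearW => [a a' s|a s s'|k a s|k a s].
  - by rewrite -tlift_addf; apply: eq_tlift => b c; exact: FD.
  - exact: (tliftD (FB a)).
  - by rewrite -tlift_scalef; apply: eq_tlift => b c; exact: FZ.
  - exact: (tliftZ (FB a)).
have AB := @tassoc_bilinear R H H H.
set G := fun a s => tlift (F a) s in GB.
transitivity (tlift G (tassoc (tmap comul idfun (comul h)))).
  rewrite /tassoc [in RHS](tlift_sum (tens_repr (comul h)) _ AB).
  rewrite [RHS](tlift_sum (tens_repr (comul h)) _ GB).
  apply: eq_bigr => p _; rewrite (tliftE AB).
  rewrite [RHS](tlift_sum (tens_repr (comul p.1)) _ GB).
  by apply: eq_bigr => q _; rewrite (tliftE GB) /G (tliftE (FB _)).
rewrite comulA [LHS](tlift_sum (tens_repr (comul h)) _ GB).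
by apply: eq_bigr => p _; rewrite (tliftE GB).
Qed.

Lemma counitlP W (f : {linear H -> W}) h :
  tlift (fun a b => counit a *: f b) (comul h) = f h.
Proof.
rewrite -[in RHS](counitl h) linear_sum.
by apply: eq_bigr => p _; rewrite linearZ.
Qed.

Lemma counitrP W (f : {linear H -> W}) h :
  tlift (fun a b => counit b *: f a) (comul h) = f h.
Proof.
rewrite -[in RHS](counitr h) linear_sum.
by apply: eq_bigr => p _; rewrite linearZ.
Qed.

Definition is_grouplike (g : H) : bool :=
  (comul g == g ⊗ g) && (counit g == 1).

Record grouplike := Grouplike { grval : H; _ : is_grouplike grval }.

HB.instance Definition _ := [isSub for grval].
HB.instance Definition _ := [Choice of grouplike by <:].

Implicit Types g : grouplike.

Lemma comul_gr g : comul (grval g) = grval g ⊗ grval g.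
Proof. by case: g => g /= /andP[/eqP]. Qed.

Lemma counit_gr g : counit (grval g) = 1.
Proof. by case: g => g /= /andP[_ /eqP]. Qed.

Lemma mulSbil : bilinear_for *:%R *:%R (fun a b : H => antipode a * b).
Proof.
by apply: bilinearW => *;
  rewrite ?(linearD, linearZ_LR) ?(mulrDl, mulrDr) -?(scalerAl, scalerAr).
Qed.

Lemma mulrSbil : bilinear_for *:%R *:%R (fun a b : H => a * antipode b).
Proof.
by apply: bilinearW => *;
  rewrite ?(linearD, linearZ_LR) ?(mulrDl, mulrDr) -?(scalerAl, scalerAr).
Qed.

Lemma antipode_gr g : antipode (grval g) * grval g = 1.
Proof.
have := antipodel (grval g).
by rewrite comul_gr (tliftE mulSbil) counit_gr scale1r.
Qed.

Lemma gr_antipode g : grval g * antipode (grval g) = 1.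
Proof.
have := antipoder (grval g).
by rewrite comul_gr (tliftE mulrSbil) counit_gr scale1r.
Qed.

Fact gr_one_subproof : is_grouplike 1.
Proof. by rewrite /is_grouplike comul1 counit1 !eqxx. Qed.

Fact gr_mul_subproof g g' : is_grouplike (grval g * grval g').
Proof.
rewrite /is_grouplike comulM counitM !comul_gr !counit_gr mul_tens mulr1.
by rewrite !eqxx.
Qed.

Fact gr_inv_subproof g : is_grouplike (antipode (grval g)).
Proof.
set s := antipode _; apply/andP; split; apply/eqP.
  rewrite -[LHS]mulr1.
  have <- : (grval g ⊗ grval g) * (s ⊗ s) = 1.
    by rewrite mul_tens gr_antipode.
  by rewrite mulrA -comul_gr -comulM antipode_gr comul1 mul1r.
have := congr1 (@counit R H) (antipode_gr g).
by rewrite counitM counit1 counit_gr mulr1.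
Qed.

(* The inverse of a grouplike [g] is [antipode g], which is its two-sided
   inverse in [H] by [antipode_gr] and [gr_antipode]. *)
Definition gr_one := Grouplike gr_one_subproof.
Definition gr_mul g g' := Grouplike (gr_mul_subproof g g').
Definition gr_inv g := Grouplike (gr_inv_subproof g).

Fact gr_mulA : associative gr_mul.
Proof. by move=> x y z; apply: val_inj; rewrite /= mulrA. Qed.
Fact gr_mul1 : left_id gr_one gr_mul.
Proof. by move=> x; apply: val_inj; rewrite /= mul1r. Qed.
Fact gr_mulr1 : right_id gr_one gr_mul.
Proof. by move=> x; apply: val_inj; rewrite /= mulr1. Qed.
Fact gr_mulV : left_inverse gr_one gr_inv gr_mul.
Proof. by move=> x; apply: val_inj; rewrite /= antipode_gr. Qed.
Fact gr_mulrV : right_inverse gr_one gr_inv gr_mul.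
Proof. by move=> x; apply: val_inj; rewrite /= gr_antipode. Qed.

HB.instance Definition _ :=
  isGroup.Build grouplike gr_mulA gr_mul1 gr_mulr1 gr_mulV gr_mulrV.

(* The group of weights: product is convolution, one the counit, inverse the
   composite with the antipode; see [weightME], [weight1E], [weightVE]. *)
Definition weight : Type := {lrmorphism H -> R^o}.

HB.instance Definition _ := gen_eqMixin weight.
HB.instance Definition _ := gen_choiceMixin weight.

Lemma weightP (l n : weight) : l =1 n -> l = n.
Proof.
case: l n => l ml [n mn] /= eq_ln.
have {}eq_ln : l = n by exact/funext.
subst n; congr GRing.LRMorphism.Pack.
case: ml mn => [[m1] [m2] [m3]] [[n1] [n2] [n3]].
by congr GRing.LRMorphism.Class; congr (_ _); exact: Prop_irrelevance.
Qed.

Implicit Types l m n : weight.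

Lemma weightD l x y : l (x + y) = l x + l y.
Proof. exact: raddfD. Qed.

Lemma weightZ l k x : l (k *: x) = (k : R^o) * l x.
Proof. exact: linearZ_LR. Qed.

Lemma antipodeZ k (x : H) : antipode (k *: x) = k *: antipode x.
Proof. exact: linearZ_LR. Qed.

(* [l ⊗ n] followed by the identification of [R ⊗ R] with [R]. *)
Definition wtens (l n : H -> R^o) : tensor H H -> R^o :=
  tlift (fun a b => l a * n b).
Definition convol (l n : H -> R^o) : H -> R^o := fun h => wtens l n (comul h).

Lemma wtens_bilinear (l n : {linear H -> R^o}) :
  bilinear_for *:%R *:%R (fun a b => l a * n b : R^o).
Proof.
apply: bilinearW => [a a' b|a b b'|k a b|k a b].
- by rewrite linearD mulrDl.
- by rewrite linearD mulrDr.
- by rewrite linearZ_LR; exact/esym/mulrA.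
- by rewrite linearZ_LR; exact: mulrCA.
Qed.

Fact wtensM l n : {morph wtens l n : s t / s * t}.
Proof.
move=> s t; have B := wtens_bilinear l n.
have w0 : wtens l n 0 = 0 by have := tliftZ B 0 0; rewrite !scale0r.
rewrite /wtens in w0 *; elim/tens_ind: s => [|a b s IHs].
  by rewrite mul0r w0 mul0r.
rewrite mulrDl !(tliftD B) IHs mulrDl; congr (_ + _) => {s IHs}.
elim/tens_ind: t => [|c d t IHt]; first by rewrite mulr0 w0 mulr0.
rewrite mulrDr !(tliftD B) IHt mulrDr; congr (_ + _).
by rewrite mul_tens !(tliftE B) !rmorphM; exact: mulrACA.
Qed.

Fact convol_linear (l n : {linear H -> R^o}) : linear (convol l n).
Proof.
move=> k x y; rewrite /convol comulP /wtens.
by rewrite (tlift_linear (wtens_bilinear l n)).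
Qed.

Fact convol_monoid_morphism l n : monoid_morphism (convol l n).
Proof.
split; last by move=> x y; rewrite /convol comulM wtensM.
by rewrite /convol comul1 /wtens (tliftE (wtens_bilinear l n)) !rmorph1 mulr1.
Qed.

Section Convolution.
Variables l n : weight.
HB.instance Definition _ :=
  GRing.isLinear.Build R H R^o *:%R (convol l n) (convol_linear l n).
HB.instance Definition _ :=
  GRing.isMonoidMorphism.Build H R^o (convol l n) (convol_monoid_morphism l n).
End Convolution.

Fact convol_antipoder l h :
  tlift (fun a b => l a * l (antipode b) : R^o) (comul h) = counit h.
Proof.
transitivity (l (counit h)%:A); last by rewrite linearZ_LR rmorph1; exact: mulr1.
rewrite -antipoder linear_sum.
by apply: eq_bigr => p _; rewrite rmorphM.
Qed.

Fact convol_antipodel l h :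
  tlift (fun a b => l (antipode a) * l b : R^o) (comul h) = counit h.
Proof.
transitivity (l (counit h)%:A); last by rewrite linearZ_LR rmorph1; exact: mulr1.
rewrite -antipodel linear_sum.
by apply: eq_bigr => p _; rewrite rmorphM.
Qed.

Lemma regZE (k x : R^o) : (k : R) *: x = k * x.
Proof. by []. Qed.

Lemma convol_expand l (f : {linear H -> R^o}) h : f h =
  tlift (fun a c => tlift (fun a1 a2 =>
    f a1 * l a2 * l (antipode c) : R^o) (comul a)) (comul h).
Proof.
pose F a b c : R^o := f a * l b * l (antipode c).
rewrite (@coassocP _ F); first last.
- by move=> k a b c; rewrite /F linearZ_LR !regZE !mulrA.
- by move=> a a' b c; rewrite /F linearD !mulrDl.
- move=> a; apply: bilinearW => *; rewrite /F.
  + by rewrite linearD mulrDr mulrDl.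
  + by rewrite !linearD mulrDr.
  + by rewrite weightZ !regZE !mulrA; congr (_ * _ * _); exact: mulrC.
  + by rewrite antipodeZ weightZ; exact: mulrCA.
rewrite -[LHS]counitrP; apply: eq_tlift => a b.
rewrite -(convol_antipoder l) /tlift scaler_suml; apply: eq_bigr => p _.
rewrite regZE /F -mulrA; exact: mulrC.
Qed.

Fact convol_antipodelM l x y :
  \sum_(p <- tens_repr (comul x)) \sum_(q <- tens_repr (comul y))
    l (antipode (p.1 * q.1)) * (l p.2 * l q.2) = counit x * counit y.
Proof.
pose lS : {linear H -> R^o} := l \o antipode.
have B := wtens_bilinear lS l.
rewrite -counitM -(convol_antipodel l) comulM.
rewrite [RHS](tlift_sum (tens_repr (comul x)) _ B); apply: eq_bigr => p _.
rewrite [RHS](tlift_sum (tens_repr (comul y)) _ B); apply: eq_bigr => q _.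
by rewrite [RHS](tliftE B) rmorphM.
Qed.

Fact weight_antipode_morphism l : monoid_morphism (l \o antipode).
Proof.
split=> [|x y].
  have := congr1 l (antipode_gr gr_one).
  by rewrite /= mulr1 rmorph1.
pose lS : {linear H -> R^o} := l \o antipode.
rewrite -![(_ \o _) _]/(lS _).
pose fx b : {linear H -> R^o} := lS \o (b \o* idfun).
pose fy a : {linear H -> R^o} := lS \o (a \*o idfun).
transitivity (\sum_(p <- tens_repr (comul x)) \sum_(q <- tens_repr (comul y))
    counit p.1 * counit q.1 * (lS p.2 * lS q.2)); last first.
  rewrite -(counitlP lS x) -(counitlP lS y) /tlift big_distrlr /=.
  by apply: eq_bigr => p _; apply: eq_bigr => q _; exact: mulrACA.
rewrite -[LHS]/(fx y x) (convol_expand l (fx y)); apply: eq_bigr => p _.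
transitivity (\sum_(q <- tens_repr (comul y))
   \sum_(p' <- tens_repr (comul p.1)) \sum_(q' <- tens_repr (comul q.1))
    lS (p'.1 * q'.1) * (l p'.2 * l q'.2) * (lS p.2 * lS q.2)); last first.
  apply: eq_bigr => q _; rewrite -(convol_antipodelM l) mulr_suml.
  by apply: eq_bigr => p' _; rewrite mulr_suml.
rewrite exchange_big; apply: eq_bigr => p' _ /=.
have -> : l (antipode (p'.1 * y)) = fy p'.1 y by [].
rewrite (convol_expand l (fy p'.1)) !mulr_suml; apply: eq_bigr => q _.
rewrite !mulr_suml; apply: eq_bigr => q' _.
have AC (a b c d e : R) : a * b * c * d * e = a * (d * b) * (e * c).
  by rewrite !mulrA [a * b * c * d]mulrAC [a * b * d]mulrAC [LHS]mulrAC.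
exact: AC.
Qed.

Section WeightInverse.
Variable l : weight.
Let lS : H -> R^o := l \o antipode.
HB.instance Definition _ := GRing.Linear.copy lS (l \o antipode).
HB.instance Definition _ :=
  GRing.isMonoidMorphism.Build H R^o lS (weight_antipode_morphism l).
Definition weight_inv : weight := lS.
End WeightInverse.

Definition weight_one : weight := counit.
Definition weight_mul l n : weight := convol l n.

Fact weight_mulA : associative weight_mul.
Proof.
move=> l m n; apply: weightP => h.
pose F a b c : R^o := l a * m b * n c.
transitivity
  (tlift (fun a b => tlift (fun b1 b2 => F a b1 b2) (comul b)) (comul h)).
  apply: eq_bigr => p _.
  have -> : weight_mul m n p.2 = \sum_(q <- tens_repr (comul p.2))
    (m q.1 * n q.2 : R^o) by [].
  rewrite mulr_sumr.
  by apply: eq_bigr => q _; rewrite /F mulrA.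
rewrite -(@coassocP _ F).
- apply: eq_bigr => p _.
  have -> : weight_mul l m p.1 = \sum_(q <- tens_repr (comul p.1))
    (l q.1 * m q.2 : R^o) by [].
  by rewrite mulr_suml.
- move=> a; apply: bilinearW => *; rewrite /F.
  + by rewrite weightD mulrDr mulrDl.
  + by rewrite weightD mulrDr.
  + by rewrite weightZ !regZE !mulrA; congr (_ * _ * _); exact: mulrC.
  + by rewrite weightZ; exact: mulrCA.
- by move=> a a' b c; rewrite /F weightD !mulrDl.
- by move=> k a b c; rewrite /F weightZ !regZE !mulrA.
Qed.

Fact weight_mul1 : left_id weight_one weight_mul.
Proof. by move=> l; apply: weightP => h; exact: counitlP. Qed.

Fact weight_mulr1 : right_id weight_one weight_mul.
Proof.
move=> l; apply: weightP => h; rewrite -[RHS]counitrP.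
by apply: eq_tlift => a b; exact: mulrC.
Qed.

Fact weight_mulV : left_inverse weight_one weight_inv weight_mul.
Proof. by move=> l; apply: weightP => h; exact: convol_antipodel. Qed.

Fact weight_mulrV : right_inverse weight_one weight_inv weight_mul.
Proof. by move=> l; apply: weightP => h; exact: convol_antipoder. Qed.

HB.instance Definition _ := isGroup.Build weight
  weight_mulA weight_mul1 weight_mulr1 weight_mulV weight_mulrV.

Lemma weight1E h : (1%g : weight) h = counit h.
Proof. by []. Qed.

Lemma weightME l n h :
  (l * n)%g h = tlift (fun a b => l a * n b : R^o) (comul h).
Proof. by []. Qed.

Lemma weightVE l h : (l^-1)%g h = l (antipode h).
Proof. by []. Qed.

Definition skew_primitive (g g' : grouplike) (h : H) : Prop :=
  comul h = grval g ⊗ h + h ⊗ grval g'.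

Definition GPi (Pi : {fset weight}) : {pred grouplike} :=
  [pred g : grouplike | all (fun gamma : weight => gamma (grval g) == 1) Pi].

Definition SigmaPi (Pi : {fset weight}) (h : H) : R :=
  \sum_(gamma <- Pi) gamma h.

End HopfTheory.

(* Main.v *)
(** Since [g_i^-1 g_i'] is sent to [1] by every weight of [Pi], the normalized
    element [x = g_i^-1 h_i] satisfies [(gamma * nu) x = gamma x + nu x] on [Pi].
    Evaluation at [x] is thus an additive character of the finite group [Pi];
    summing this identity over [nu] gives [#|Pi| gamma x = 0], hence
    [gamma x = 0] as [#|Pi|] is nonzero in the domain [R]. *)
Require Import Defs.
From mathcomp Require Import all_boot all_order all_algebra.
From mathcomp Require Import finmap.

Import GRing.Theory.
Local Open Scope ring_scope.

Lemma weight_skew_primitive (R : comNzRingType) (H : hopfAlgType R)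
  (g g' : grouplike H) (x : H) (l m : weight H) :
  skew_primitive g g' x ->
  ((l * m)%g : weight H) x = l (grval g) * m x + l x * m (grval g').
Proof.
have B := wtens_bilinear l m.
by move=> Dx; rewrite weightME Dx (tliftD B) !(tliftE B).
Qed.

(** Taking [k] to be the inverse of [g] makes the left grouplike trivial. *)
Lemma skew_primitive_mull (R : comNzRingType) (H : hopfAlgType R)
  (k g g' : grouplike H) (x : H) :
  skew_primitive g g' x ->
  skew_primitive (k * g)%g (k * g')%g (grval k * x).
Proof.
by move=> Dx; rewrite /skew_primitive comulM Dx comul_gr mulrDr !mul_tens.
Qed.

(** Translation by [a] is injective, and [b] has the preimage [a^-1 * b] in [G]. This permits
    reindexing sums over [G]. *)
Lemma fset_group_lmul (T : groupType) (G : {fset T}) (a : T) :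
  group_closed [in G] -> a \in G -> perm_eq [seq (a * b)%g | b <- G] G.
Proof.
move=> Ggrp Ga; have GM := group_closedM Ggrp.
apply: uniq_perm => [||b]; [|exact: fset_uniq|].
  by rewrite (map_inj_uniq (mulgI a)) fset_uniq.
apply/mapP/idP => [[c Gc ->]|Gb]; first exact: GM.
exists (a^-1 * b)%g; last by rewrite mulVKg.
by apply: GM => //; exact: group_closedV.
Qed.

Lemma additive_character_eq0 (R : idomainType) (T : groupType) (G : {fset T})
  (f : T -> R) :
  group_closed [in G] ->
  (forall p : nat, p \in [pchar R] -> ~~ (p %| #|` G|)%N) ->
  {in G &, forall a b, f (a * b)%g = f a + f b} ->
  {in G, forall a, f a = 0}.
Proof.
move=> Ggrp char_G fM a Ga.
have : \sum_(b <- G) f b = \sum_(b <- G) (f a + f b).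
  rewrite -[LHS](perm_big _ (fset_group_lmul _ _ _ Ggrp Ga)) big_map.
  by apply: eq_big_seq => b Gb; exact: fM.
rewrite big_split /= -[LHS]add0r => /addIr/esym/eqP.
rewrite big_const_seq count_predT iter_addr_0 -mulr_natr mulf_eq0.
case/orP=> [/eqP //|G0].
(* A positive integer vanishing in [R] forces a prime characteristic, which then divides it. *)
have G_gt0 : (0 < #|` G|)%N by rewrite cardfs_gt0; apply/fset0Pn; exists a.
have [p char_p] := natf0_pchar G_gt0 G0.
by case/negP: (char_G p char_p); rewrite (dvdn_pcharf char_p).
Qed.

Theorem proposition5p5 (R : idomainType) (H : hopfAlgType R)
  (Pi : {fset weight H}) (Pi_group : group_closed [in Pi])
  (n : nat) (n_gt0 : (0 < n)%N)
  (h : 'I_n -> H) (g g' : 'I_n -> grouplike H)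
  (h_skew : forall i, skew_primitive (g i) (g' i) (h i))
  (char_Pi : forall p : nat, p \in [pchar R] -> ~~ (p %| #|` Pi|)%N)
  (i : 'I_n) (h_pseudo : ((g i)^-1 * g' i)%g \in GPi Pi) :
  (forall gamma : weight H, gamma \in Pi -> gamma (h i) = 0) /\
  SigmaPi Pi (\prod_(j < n) h j) = 0.
Proof.
have h0 (l : weight H) : l \in Pi -> l (h i) = 0.
  move=> Pil; pose x := grval (g i)^-1%g * h i.
  (* The normalization is undone by [h i = g i * x], so it suffices to treat [x]. *)
  have -> : l (h i) = l (grval (g i)) * l x.
    by rewrite -rmorphM mulrA gr_antipode mul1r.
  suff -> : l x = 0 by rewrite mulr0.
  pose ev (k : weight H) : R := k x.
  apply: (additive_character_eq0 _ _ _ ev Pi_group char_Pi _ _ Pil).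
  move=> {Pil}l m Pil Pim; rewrite /ev.
  (* The grouplikes attached to [x] are [1] and [(g i)^-1 * g' i]; [l] sends the first to [1], and
     [m] the second by [h_pseudo]. *)
  have := skew_primitive_mull _ _ (g i)^-1%g _ _ _ (h_skew i).
  move/weight_skew_primitive->; rewrite mulVg rmorph1 mul1r addrC.
  by move/allP/(_ m Pim)/eqP: h_pseudo => ->; rewrite mulr1.
split=> //; apply: big1_seq => l /= Pil.
(* [H] may be noncommutative, but the images under [l] commute in [R], so the zero factor at [i] can
   be pulled out. *)
by rewrite rmorph_prod (bigD1 i) //= h0 ?mul0r.
Qed.
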